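(* Let $k\geq 3$ and $q>k$ be integers. Then for the Sperner-admissible labeling $\ell:V_{k,q}\to[k]$, $\ell(\bm{v})=i(\bm{v})+1$, each hyperedge of the simplex-lattice hypergraph $H_{k,q}$ uses at most 2 colors; that is, for every $\bm{v}\in V_{k,q-1}$ the set $\{\ell(\bm{w}):\bm{w}\in F(\bm{v})\}$ has at most 2 elements.
   Context: Notation: $[k]=\{1,\dots,k\}$ and $[0,k]=\{0,1,\dots,k\}$; $e_1,\dots,e_{k-1}$ is the standard basis of $\mathbb{R}^{k-1}$. For integers $k\ge 3$ and $q\geq 1$, let $V_{k,q}=\{\bm{v}=(v_1,\dots,v_{k-1})\in\mathbb{Z}^{k-1}: 0\le v_1\le v_2\le\cdots\le v_{k-1}\le q\}$, and let $V_{k,q-1}$ be the analogous set with $q-1$ in place of $q$. The simplex-lattice hypergraph $H_{k,q}$ is the $k$-uniform hypergraph with vertex set $V_{k,q}$ and hyperedge set $E_{k,q}=\{F(\bm{v}):\bm{v}\in V_{k,q-1}\}$, where $F(\bm{v})=\{\bm{v},\ \bm{v}+e_{k-1},\ \bm{v}+e_{k-1}+e_{k-2},\ \dots,\ \bm{v}+e_{k-1}+e_{k-2}+\cdots+e_1\}$. For $\bm{v}\in V_{k,q}$ we use the convention $v_0=0$ and $v_k=q$. A labeling $\ell:V_{k,q}\to[k]$ is Sperner-admissible if $v_i>v_{i-1}$ whenever $\ell(\bm{v})=i$. For $\bm{v}\in V_{k,q}$ define $r(\bm{v})=\max\{t-v_t:t\in[0,k]\}$, $i(\bm{v})=\min\{t\in[0,k]:t-v_t=r(\bm{v})\}$,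 and $\ell(\bm{v})=i(\bm{v})+1$. *)

(* Defs.v *)
From HB Require Import structures.
From mathcomp Require Import all_boot all_order all_algebra.
From mathcomp Require Import finmap zify.

Set Implicit Arguments.
Unset Strict Implicit.
Unset Printing Implicit Defensive.

Import Order.TTheory GRing.Theory Num.Theory.
Local Open Scope ring_scope.

(* Edges are finite sets, although the ambient type T of the vertices may be
   infinite. *)
Record uniform_hypergraph (k : nat) (T : choiceType) := UniformHypergraph {
  vertices : {pred T};
  hyperedges : {fset T} -> Prop;
  hyperedges_sub : forall e, hyperedges e -> {subset e <= vertices};
  hyperedges_uniform : forall e, hyperedges e -> #|` e| = k
}.

(* [ext_coord q v t] is v_t for t in [0, k], with v_0 = 0 and v_k = q.
   Mathematical indices start at 1, whereas v is indexed by 'I_(k.-1). *)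
Definition ext_coord (k : nat) (q : int) (v : 'rV[int]_k.-1) (t : nat) : int :=
  if t == 0 then 0
  else if insub t.-1 is Some i then v ord0 i else q.

(* The chain 0 <= v_1 <= ... <= v_(k-1) <= q. *)
Definition lattice_points (k : nat) (q : int) : {pred 'rV[int]_k.-1} :=
  [pred v | [forall t : 'I_k, ext_coord q v t <= ext_coord q v t.+1]].
Arguments lattice_points k q : clear implicits.

(* v + e_(k-1) + ... + e_(k-j).  The basis vector e_m is [delta_mx ord0 i] with
   i = m - 1, so the condition m >= k - j reads k - 1 <= i + j. *)
Definition shifted (k : nat) (v : 'rV[int]_k.-1) (j : nat) : 'rV[int]_k.-1 :=
  v + \sum_(i < k.-1 | (k.-1 <= i + j)%N) delta_mx ord0 i.

(* The set F(v). *)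
Definition cell (k : nat) (v : 'rV[int]_k.-1) : {fset 'rV[int]_k.-1} :=
  [fset shifted v (nat_of_ord j) | j in 'I_k]%fset.

Definition is_cell (k : nat) (q : int) (e : {fset 'rV[int]_k.-1}) : Prop :=
  exists2 v : 'rV[int]_k.-1, v \in lattice_points k (q - 1) & e = cell v.

Lemma ext_coordS (k : nat) (q : int) (v : 'rV[int]_k.-1) (i : 'I_k.-1) :
  ext_coord q v i.+1 = v ord0 i.
Proof. by rewrite /ext_coord /= valK. Qed.

Lemma ext_coord_last (k : nat) (q : int) (v : 'rV[int]_k.-1) (t : nat) :
  (0 < t)%N -> (k <= t)%N -> ext_coord q v t = q.
Proof.
case: t => // t _ kt; rewrite /ext_coord /= insubF //.
by apply/negbTE; rewrite -leqNgt; lia.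
Qed.

Lemma shiftedE (k : nat) (v : 'rV[int]_k.-1) (j : nat) (i : 'I_k.-1) :
  shifted v j ord0 i = v ord0 i + (k.-1 <= i + j)%N%:R.
Proof.
rewrite /shifted mxE summxE; congr (_ + _).
rewrite big_mkcond /= (bigD1 i) //= mxE !eqxx big1 ?addr0; first by case: ifP.
by move=> l li; rewrite mxE [i == l]eq_sym (negbTE li) andbF; case: ifP.
Qed.

Lemma ext_coord_shifted (k : nat) (q : int) (v : 'rV[int]_k.-1) (j t : nat) :
  (t <= k)%N ->
  ext_coord q (shifted v j) t =
    ext_coord (q - 1) v t + ((0 < t) && ((k <= t + j) || (t == k)))%N%:R.
Proof.
case: t => [|t] tk; first by rewrite /ext_coord /= addr0.
have [tk'|tk'] := ltnP t k.-1; last first.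
  by rewrite !ext_coord_last //; lia.
have -> : t = Ordinal tk' by [].
by rewrite !ext_coordS shiftedE /=; congr (_ + _%:R); lia.
Qed.

Lemma is_cell_sub (k : nat) (q : int) (e : {fset 'rV[int]_k.-1}) :
  is_cell q e -> {subset e <= lattice_points k q}.
Proof.
case=> v /forallP vV -> w /imfsetP[/= j _ ->]; apply/forallP => t.
have := vV t; have := ltn_ord t; have := ltn_ord j => jk tk le_v.
by rewrite !ext_coord_shifted ?(ltnW tk) //; apply: lerD => //; lia.
Qed.

Lemma is_cell_uniform (k : nat) (q : int) (e : {fset 'rV[int]_k.-1}) :
  is_cell q e -> #|` e| = k.
Proof.
case=> v _ ->; rewrite card_imfset /=; first by rewrite -cardE card_ord.
have shift_neq (a b : 'I_k) : (a < b)%N -> shifted v a != shifted v b.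
  move=> ab; have bk := ltn_ord b.
  have ik : (k.-1 - b < k.-1)%N by lia.
  apply/eqP => /rowP/(_ (Ordinal ik)); rewrite !shiftedE /=; lia.
move=> a b eq_ab; apply/val_inj/eqP => /=.
by case: ltngtP => // /shift_neq; rewrite eq_ab eqxx.
Qed.

Definition simplex_lattice (k : nat) (q : int) :
    uniform_hypergraph k 'rV[int]_k.-1 :=
  UniformHypergraph (@is_cell_sub k q) (@is_cell_uniform k q).

(* A labeling V_(k,q) -> [k], given by a function on the whole of Z^(k-1). *)
Definition labeling (k : nat) (q : int) (l : 'rV[int]_k.-1 -> nat) : Prop :=
  forall v, v \in vertices (simplex_lattice k q) -> (1 <= l v <= k)%N.

Definition sperner_admissible (k : nat) (q : int) (l : 'rV[int]_k.-1 -> nat) :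
    Prop :=
  forall v, v \in vertices (simplex_lattice k q) ->
  forall i : nat, (1 <= i <= k)%N -> l v = i ->
  ext_coord q v i.-1 < ext_coord q v i.

Definition excess (k : nat) (q : int) (v : 'rV[int]_k.-1) (t : 'I_k.+1) : int :=
  t%:Z - ext_coord q v t.
Arguments excess {k} q v t.

Definition argmax_excess (k : nat) (q : int) (v : 'rV[int]_k.-1) : 'I_k.+1 :=
  [arg max_(t > ord0) excess q v t]%O.

(* r(v) *)
Definition max_excess (k : nat) (q : int) (v : 'rV[int]_k.-1) : int :=
  excess q v (argmax_excess q v).

(* i(v); [argmax_excess q v] only witnesses that the set whose minimum is taken
   is nonempty. *)
Definition first_max (k : nat) (q : int) (v : 'rV[int]_k.-1) : 'I_k.+1 :=
  [arg min_(t < argmax_excess q v | excess q v t == max_excess q v) (t : nat)]%N.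

Definition label (k : nat) (q : int) (v : 'rV[int]_k.-1) : nat :=
  (first_max q v).+1.
Arguments label {k} q v.

(* Main.v *)
(* Let a(t) = t - v_t with maximum M, let p be the first t with a(t) = M, and
   p' the first t with a(t) >= M - 1.  Passing from v to a vertex of F(v) lowers
   the values a(t) by one on a final segment [s, k] with s > 0.  If p < s, the
   first maximum stays at p.  Otherwise the new maximum is M - 1, and it is first
   attained at p' if p' < s and at p if s <= p'. *)
Require Import Defs.
From mathcomp Require Import all_boot all_order all_algebra.
From mathcomp Require Import finmap zify.

Import Order.TTheory GRing.Theory Num.Theory.
Local Open Scope ring_scope.

Lemma first_max_ge {k : nat} (q : int) (v : 'rV[int]_k.-1) (t : 'I_k.+1) :
  excess q v t <= excess q v (first_max q v).
Proof.
rewrite /first_max; case: arg_minnP => [//|i /eqP-> _].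
rewrite /max_excess /argmax_excess.
by case: Order.TotalTheory.arg_maxP => // j _; apply.
Qed.

Lemma first_max_gt {k : nat} {q : int} {v : 'rV[int]_k.-1} {t : 'I_k.+1} :
  (t < first_max q v)%N -> excess q v t < excess q v (first_max q v).
Proof.
move=> lt_t; rewrite lt_neqAle first_max_ge andbT; move: lt_t.
rewrite /first_max; case: arg_minnP => [//|i /eqP-> min_i].
by rewrite ltnNge; apply: contra => /min_i.
Qed.

Lemma first_max_eq {k : nat} {q : int} (v : 'rV[int]_k.-1) (i : 'I_k.+1) :
  (forall t, excess q v t <= excess q v i) ->
  (forall t : 'I_k.+1, (t < i)%N -> excess q v t < excess q v i) ->
  first_max q v = i.
Proof.
move=> ge_i gt_i; apply/val_inj/eqP => /=.
have := first_max_ge q v i; have := ge_i (first_max q v).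
case: ltngtP => // [/gt_i|/first_max_gt]; lia.
Qed.

Lemma excess0 (k : nat) (q : int) (v : 'rV[int]_k.-1) : excess q v ord0 = 0.
Proof. by []. Qed.

Lemma excess_max (k : nat) (q : int) (v : 'rV[int]_k.-1) :
  (0 < k)%N -> excess q v ord_max = k%:Z - q.
Proof. by move=> k0; rewrite /excess ext_coord_last. Qed.

(** The cell is based at a point of level q - 1 but its vertices have level q, so the convention at
    t = k alone lowers the last value by one, for every j. *)
Lemma excess_shifted {k : nat} {q : int} (v : 'rV[int]_k.-1) (j : nat)
    (t : 'I_k.+1) :
  excess q (shifted v j) t =
    excess (q - 1) v t - ((0 < t) && ((k <= t + j) || (t == k :> nat)))%N%:R.
Proof. by rewrite /excess ext_coord_shifted -1?ltnS // opprD addrA. Qed.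

(** The value at k is k - q <= 0, which index 0 already attains. *)
Lemma first_max_lt {k : nat} {q : int} (v : 'rV[int]_k.-1) :
  (0 < k)%N -> k%:Z <= q -> (first_max q v < k)%N.
Proof.
move=> k0 kq; rewrite ltn_neqAle -ltnS ltn_ord andbT; apply/eqP => eq_k.
have/first_max_gt : ((ord0 : 'I_k.+1) < first_max q v)%N by rewrite eq_k.
have -> : first_max q v = ord_max by apply: val_inj.
by rewrite excess0 excess_max //; lia.
Qed.

Lemma label_sperner (k : nat) (q : int) :
  (0 < k)%N -> k%:Z <= q -> sperner_admissible q (@label k q).
Proof.
move=> k0 kq v _ i ik <- {i ik}; rewrite /label /=.
have lt_k := first_max_lt v k0 kq.
(* Maximality at p against p + 1 reads p + 1 - v_(p+1) <= p - v_p, that is, v_p < v_(p+1). *)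
have := first_max_ge q v (Ordinal (lt_k : (_.+1 < k.+1)%N)).
rewrite /excess /=; lia.
Qed.

(** The index p' is chosen before j, so the same pair serves all vertices of the cell. *)
Lemma first_max_shifted {k : nat} {q : int} (v : 'rV[int]_k.-1) :
  (0 < k)%N -> k%:Z < q ->
  exists p' : 'I_k.+1, forall j : nat, (j < k)%N ->
    first_max q (shifted v j) \in [:: first_max (q - 1) v; p'].
Proof.
move=> k0 kq; set a := excess (q - 1) v; set p := first_max (q - 1) v.
have ge_p : forall t, a t <= a p := first_max_ge (q - 1) v.
have gt_p : forall t : 'I_k.+1, (t < p)%N -> a t < a p.
  by move=> t; apply: first_max_gt.
have lt_p : (p < k)%N by apply: first_max_lt => //; lia.
have hp : a p - 1 <= a p by lia.
case: (arg_minnP (fun t : 'I_k.+1 => t : nat) (hp : (fun t => a p - 1 <= a t) p)).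
move=> p' ge_p' min_p'; exists p' => j jk; rewrite !inE.
(* Here s = k - j, and [sp] means s <= p. *)
have [sp|ps] := boolP ((0 < p) && (k <= p + j))%N; last first.
  apply/orP; left; apply/eqP/first_max_eq => t; rewrite !excess_shifted -/a.
    have := ge_p t; lia.
  move=> /[dup] tp /gt_p; lia.
(* If s <= p', the values before p' are at most M - 2, and those M - 1 on [p', p) drop to M - 2. *)
have [sp'|ps'] := boolP ((0 < p') && (k <= p' + j))%N.
  apply/orP; left; apply/eqP/first_max_eq => t; rewrite !excess_shifted -/a.
    have := ge_p t; have := min_p' t; have := gt_p t; lia.
  move=> /[dup] tp /gt_p; have := min_p' t; lia.
(* Now p' < s <= p, so a(p') is exactly M - 1 and is not lowered. *)
apply/orP; right; apply/eqP/first_max_eq => t; rewrite !excess_shifted -/a.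
  have := ge_p t; have := gt_p t; have := gt_p p'; lia.
have := min_p' t; have := min_p' p hp; have := gt_p p'; lia.
Qed.

Theorem theorem1 (k : nat) (q : int) (hk : (3 <= k)%N) (hq : k%:Z < q) :
  [/\ labeling q (@label k q),
      sperner_admissible q (@label k q)
    & forall e : {fset 'rV[int]_k.-1},
        hyperedges (simplex_lattice k q) e ->
        (#|` [fset label q w | w in e]%fset| <= 2)%N ].
Proof.
have k0 : (0 < k)%N by apply: leq_trans hk.
(* The range condition on [label] computes to [first_max] < k. *)
split=> [v _||e [v _ ->]]; first by apply: first_max_lt => //; apply: ltW.
  by apply: label_sperner => //; apply: ltW.
have [p' first_maxE] := first_max_shifted v k0 hq.
pose p := first_max (q - 1) v.
suff sub : ([fset label q w | w in cell v] `<=` [fset p.+1; p'.+1])%fset.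
  by apply: leq_trans (fsubset_leq_card sub) _; rewrite cardfs2; case: eqP.
apply/fsubsetP => _ /imfsetP[/= w /imfsetP[/= j _ ->] ->].
have := first_maxE j (ltn_ord j); rewrite !inE /label.
by case/orP=> /eqP->; rewrite eqxx ?orbT.
Qed.
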